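(* Let $\Omega$ be a domain in $\mathbb{R}^n$ with $n>2$, and let $f:\mathbb{R}\to\mathbb{R}$ be a function such that for every $u\in H^1(\Omega)$ the composition $f\circ u$ belongs to $C^0(\bar\Omega)$ (i.e. has a continuous representative). Then $f$ is a constant function.
   Context: $H^1(\Omega)$ is the Sobolev space of $L^2(\Omega)$ functions with weak first derivatives in $L^2(\Omega)$; $C^0(\bar\Omega)$ is the space of continuous real-valued functions on $\bar\Omega$. A function $f:\mathbb{R}\to\mathbb{R}$ is regarded as acting on functions via composition $u\mapsto f\circ u$. *)

(* Defs.v *)
From HB Require Import structures.
From mathcomp Require Import all_boot all_order all_algebra.
From mathcomp Require Import all_classical all_reals all_analysis.
Set Implicit Arguments. Unset Strict Implicit. Unset Printing Implicit Defensive.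
Import Order.TTheory GRing.Theory Num.Theory.
Import numFieldNormedType.Exports.
Local Open Scope classical_set_scope.
Local Open Scope ring_scope.

(* R^n is modelled as 'rV[R]_n (normed space,
   used for topology / derivatives); n-dimensional Lebesgue measure lives on
   n.-tuple R (product Borel sigma-algebra), transported via tup2rv. *)

Section Sobolev.
Context {R : realType} {n : nat}.

Definition tup2rv (t : n.-tuple R) : 'rV[R]_n := \row_i tnth t i.

(* mu is n-dimensional Lebesgue measure: it gives every closed box its
   volume (this characterizes Lebesgue measure on the Borel sets). *)
Definition is_lebesgue_Rn (mu : {measure set (n.-tuple R) -> \bar R}) : Prop :=
  forall a b : n.-tuple R, (forall i, tnth a i <= tnth b i) ->
    mu [set x | forall i, tnth a i <= tnth x i <= tnth b i] =
    (\prod_i (tnth b i - tnth a i))%:E.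

Definition tdom (Om : set 'rV[R]_n) : set (n.-tuple R) := tup2rv @^-1` Om.

Definition L2 (mu : {measure set (n.-tuple R) -> \bar R}) (Om : set 'rV[R]_n)
    (h : 'rV[R]_n -> R) : Prop :=
  measurable_fun (tdom Om) (h \o tup2rv) /\
  (\int[mu]_(x in tdom Om) ((`|h (tup2rv x)| ^+ 2)%:E) < +oo)%E.

Fixpoint dirder (vs : seq 'rV[R]_n) (f : 'rV[R]_n -> R) : 'rV[R]_n -> R :=
  match vs with
  | [::] => f
  | v :: vs' => fun x => 'D_v (dirder vs' f) x
  end.

Definition smooth (f : 'rV[R]_n -> R) : Prop :=
  forall vs : seq 'rV[R]_n,
    continuous (dirder vs f) /\ forall x v, derivable (dirder vs f) x v.

Definition fsupport (f : 'rV[R]_n -> R) : set 'rV[R]_n :=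
  closure [set x | f x != 0].

Definition test_fun (Om : set 'rV[R]_n) (phi : 'rV[R]_n -> R) : Prop :=
  smooth phi /\ compact (fsupport phi) /\ fsupport phi `<=` Om.

Definition ev (i : 'I_n) : 'rV[R]_n := delta_mx 0 i.

Definition weak_partial (mu : {measure set (n.-tuple R) -> \bar R})
    (Om : set 'rV[R]_n) (i : 'I_n) (u g : 'rV[R]_n -> R) : Prop :=
  forall phi, test_fun Om phi ->
    (\int[mu]_(x in tdom Om) ((u (tup2rv x) * 'D_(ev i) phi (tup2rv x))%:E)
     = - \int[mu]_(x in tdom Om) ((g (tup2rv x) * phi (tup2rv x))%:E))%E.

Definition H1 (mu : {measure set (n.-tuple R) -> \bar R}) (Om : set 'rV[R]_n)
    (u : 'rV[R]_n -> R) : Prop :=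
  L2 mu Om u /\
  forall i : 'I_n, exists g, L2 mu Om g /\ weak_partial mu Om i u g.

Definition C0_closure (mu : {measure set (n.-tuple R) -> \bar R})
    (Om : set 'rV[R]_n) (v : 'rV[R]_n -> R) : Prop :=
  exists g : 'rV[R]_n -> R,
    {within closure Om, continuous g} /\
    {ae mu, forall x, tdom Om x -> v (tup2rv x) = g (tup2rv x)}.

Definition domain (Om : set 'rV[R]_n) : Prop :=
  open Om /\ connected Om /\ Om !=set0.

End Sobolev.

(* Main.v *)
Require Import Defs.
From HB Require Import structures.
From mathcomp Require Import all_boot all_order all_algebra.
From mathcomp Require Import all_classical all_reals all_analysis.
From mathcomp Require Import measurable_realfun ring lra.
Import Order.TTheory GRing.Theory Num.Theory.
Import numFieldNormedType.Exports.
Local Open Scope classical_set_scope.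
Local Open Scope ring_scope.
Set Implicit Arguments.
Unset Strict Implicit.

(** Fix a point [p] of the domain and a value [b].  Put disjoint [C^1] bumps of
    height [b] and radius [rho_k = 2^-k] at the points [p + 3 rho_k e].  Each bump
    has Dirichlet energy of order [rho_k^(n-2)], which is summable since [n > 2],
    so the sum [u] of the bumps lies in [H^1].  The function [u] equals [b] on
    boxes accumulating at [p], and [0] on other boxes accumulating at [p];
    a continuous representative of [f o u] must therefore take both values
    [f b] and [f 0] at [p].

    Integration by parts needs neither Fubini nor a product structure:
    the box volumes determine the measure, hence it is translation invariant,
    so difference quotients of a compactly supported function have integral
    zero, and dominated convergence passes to the derivative. *)

(** * Boxes and translation invariance *)

Section Boxes.
Context {R : realType} {n : nat}.
Implicit Types a b : n.-tuple R.

Definition tbox a b : set (n.-tuple R) :=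
  [set x | forall i, tnth a i <= tnth x i <= tnth b i].

Definition tconst (c : R) : n.-tuple R := [tuple c | _ < n].

Lemma tbox_bigcap a b :
  tbox a b = \bigcap_(i in [set: 'I_n])
    ((fun x : n.-tuple R => tnth x i) @^-1` `[tnth a i, tnth b i]).
Proof.
apply/seteqP; split => x /= h.
  by move=> i _ /=; rewrite in_itv /=; exact: h.
by move=> i; have := h i I; rewrite /= in_itv.
Qed.

Lemma measurable_tbox a b : measurable (tbox a b).
Proof.
rewrite tbox_bigcap; apply: fin_bigcap_measurable => // i _.
rewrite -[X in measurable X]setTI.
by apply: measurable_tnth => //; exact: measurable_itv.
Qed.

Lemma tbox_eq0 a b i : ~ (tnth a i <= tnth b i) -> tbox a b = set0.
Proof.
move=> h; apply/seteqP; split => // x /= /(_ i) /andP[h1 h2].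
by apply: h; exact: le_trans h1 h2.
Qed.

Definition boxes : set (set (n.-tuple R)) := [set A | exists a b, A = tbox a b].

Lemma boxes_setI : setI_closed boxes.
Proof.
move=> _ _ [a [b ->]] [c [d ->]].
exists [tuple Num.max (tnth a i) (tnth c i) | i < n].
exists [tuple Num.min (tnth b i) (tnth d i) | i < n].
apply/seteqP; split => x /=.
  move=> [h1 h2] i; rewrite !tnth_mktuple ge_max le_min.
  have /andP[h11 h12] := h1 i; have /andP[h21 h22] := h2 i.
  by apply/andP; split; apply/andP.
move=> h; split => i; have := h i;
  by rewrite !tnth_mktuple ge_max le_min => /andP[/andP[? ?] /andP[? ?]]; apply/andP.
Qed.

Lemma tbox_bound (x : n.-tuple R) : exists m : nat,
  forall i, `|tnth x i| <= m%:R.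
Proof.
exists (Num.truncn (\big[Num.max/0]_i `|tnth x i|)).+1 => i.
apply: le_trans (ltW (Num.Theory.truncnS_gt _)).
by apply: (le_bigmax _ (fun i => `|tnth x i|)).
Qed.

Lemma bigcup_tbox : \bigcup_m tbox (tconst (- m%:R)) (tconst m%:R) = setT.
Proof.
apply/seteqP; split => // x _; have [m hm] := tbox_bound x.
by exists m => // i; rewrite !tnth_mktuple -ler_norml.
Qed.

(** A measure on the Borel sets is then determined by its values on the pi-system of boxes. For the
    nontrivial inclusion it suffices that each coordinate map is measurable for the generated
    sigma-algebra, which is tested on closed half-lines. *)
Lemma measurable_boxes : @measurable _ (n.-tuple R) = <<s boxes >>.
Proof.
apply/seteqP; split; last first.
  apply: smallest_sub; first exact: sigma_algebra_measurable.
  by move=> _ [a [b ->]]; exact: measurable_tbox.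
have mid : measurable_fun [set: g_sigma_algebraType boxes]
    (fun x : g_sigma_algebraType boxes => (x : n.-tuple R)).
  apply/measurable_fun_tnthP => i.
  apply: (measurability (@RGenCInfty.G R)); first exact: RGenCInfty.measurableE.
  move=> /= _ [_] [r] -> <-; rewrite setTI.
  (* A half-space is exhausted by countably many boxes: coordinate [i] stays above [r], the others
     above [-m], and all of them below [m]. *)
  have -> : ((fun x : n.-tuple R => tnth x i) \o id) @^-1` `[r, +oo[ =
    \bigcup_m tbox [tuple if j == i then r else - m%:R | j < n] (tconst m%:R).
    apply/seteqP; split => x /=; last first.
      by move=> [m _ /(_ i)]; rewrite !tnth_mktuple eqxx in_itv /= andbT => /andP[].
    rewrite in_itv /= andbT => rx; have [m hm] := tbox_bound x.
    exists m => // j; rewrite !tnth_mktuple; have := hm j; rewrite ler_norml => /andP[h1 h2].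
    by apply/andP; split => //; case: eqP => [->|_].
  apply: bigcup_measurable => m _; apply: sub_sigma_algebra.
  by eexists; eexists.
by move=> A mA; have := mid measurableT A mA; rewrite setTI.
Qed.

Definition tshift (v : 'rV[R]_n) (x : n.-tuple R) : n.-tuple R :=
  [tuple tnth x i + v 0 i | i < n].

Lemma tup2rv_tshift v x : tup2rv (tshift v x) = tup2rv x + v.
Proof. by apply/rowP => i; rewrite !mxE tnth_mktuple. Qed.

Lemma measurable_tshift v : measurable_fun setT (tshift v).
Proof.
apply/measurable_fun_tnthP => i.
rewrite (_ : _ \o _ = (fun x : n.-tuple R => tnth x i + v 0 i)); last first.
  by apply/funext => x /=; rewrite tnth_mktuple.
by apply: measurable_funD => //; exact: measurable_tnth.
Qed.

Section Lebesgue.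
Variables (mu : {measure set (n.-tuple R) -> \bar R}) (hmu : is_lebesgue_Rn mu).

Lemma tbox_measure_lty a b : (mu (tbox a b) < +oo)%E.
Proof.
have [h|/existsNP[i h]] := pselect (forall i, tnth a i <= tnth b i).
  by rewrite hmu// ltry.
by rewrite (tbox_eq0 h) measure0.
Qed.

(** Translating a box preserves its side lengths, so both measures agree on the pi-system of boxes.
    They agree on all Borel sets by uniqueness, since boxes of finite measure exhaust the space. *)
Lemma pushforward_tshift v A : measurable A ->
  pushforward mu (tshift v) A = mu A.
Proof.
move=> mA; pose f : {mfun _ >-> _} := HB.pack (tshift v)
  (isMeasurableFun.Build _ _ _ _ _ (measurable_tshift v)).
apply/esym; apply: (measure_unique boxes
  (fun m => tbox (tconst (- m%:R)) (tconst m%:R)) _ _ _ _ mu (pushforward mu f)) => //.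
- exact: measurable_boxes.
- exact: boxes_setI.
- by move=> m; eexists; eexists.
- exact: bigcup_tbox.
- move=> _ [a [b ->]].
  have E : tshift v @^-1` tbox a b = tbox (tshift (- v) a) (tshift (- v) b).
    apply/seteqP; split => x /= h i; have := h i;
    by rewrite !tnth_mktuple !mxE lerBlDr lerBrDr.
  transitivity (mu (tbox (tshift (- v) a) (tshift (- v) b))); last by rewrite -E.
  (* The volume formula covers ordered endpoints only; otherwise both boxes are empty. *)
  have [h|/existsNP[i h]] := pselect (forall i, tnth a i <= tnth b i).
    rewrite !hmu//; last by move=> i; rewrite !tnth_mktuple lerD2r.
    by congr EFin; apply: eq_bigr => i _; rewrite !tnth_mktuple; ring.
  by rewrite !(@tbox_eq0 _ _ i)//= !tnth_mktuple lerD2r.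
- by move=> k; exact: tbox_measure_lty.
Qed.

Lemma integral_tshift v (g : n.-tuple R -> \bar R) :
  mu.-integrable setT g ->
  mu.-integrable setT (g \o tshift v) /\
  (\int[mu]_x g (tshift v x) = \int[mu]_x g x)%E.
Proof.
move=> ig; have mg := measurable_int _ ig.
have ms := measurable_tshift v.
pose f : {mfun _ >-> _} := HB.pack (tshift v)
  (isMeasurableFun.Build _ _ _ _ _ ms).
have E h : (\int[mu]_x h x = \int[pushforward mu f]_x h x)%E.
  by apply: eq_measure_integral => A mA _; apply/esym; exact: pushforward_tshift.
have igs : mu.-integrable setT (g \o tshift v).
  apply/integrableP; split; first exact: measurableT_comp.
  have /integrableP[_] := ig.
  by rewrite E ge0_integral_pushforward//; exact: measurableT_comp.
split => //; rewrite [RHS]E.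
by apply/esym; apply: integral_pushforward.
Qed.

End Lebesgue.
End Boxes.

(** * Continuous functions on row vectors *)

Section RowVectors.
Context {R : realType} {n : nat}.
Implicit Types (x v : 'rV[R]_n) (h : 'rV[R]_n -> R).

Lemma coord_le_norm x i : `|x 0 i| <= `|x|.
Proof.
rewrite [leRHS]/Num.norm /= mx_normrE.
exact: (le_bigmax _ (fun ij : 'I_1 * 'I_n => `|x ij.1 ij.2|) (0, i)).
Qed.

Lemma norm_le_coord x r : 0 <= r -> (forall i, `|x 0 i| <= r) -> `|x| <= r.
Proof.
move=> r0 h; rewrite [leLHS]/Num.norm /= mx_normrE.
by apply: bigmax_le => // -[i j] _ /=; rewrite (ord1 i).
Qed.

Lemma tup2rv_box r (t : n.-tuple R) : `|tup2rv t| <= r ->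
  tbox (tconst (- r)) (tconst r) t.
Proof.
move=> h i; rewrite !tnth_mktuple -ler_norml.
have := coord_le_norm (tup2rv t) i; rewrite mxE => /le_trans; exact.
Qed.

(** The preimage of [U] is the union of the boxes contained in it that have a rational centre and
    half-side [1/(m+1)], a countable family. This links the topology of row vectors to the Borel
    sets of tuples. *)
Lemma measurable_tup2rv_open (U : set 'rV[R]_n) : open U ->
  measurable (tup2rv @^-1` U).
Proof.
move=> oU.
pose box (q : n.-tuple rat * nat) : set (n.-tuple R) :=
  tbox [tuple ratr (tnth q.1 i) - q.2.+1%:R^-1 | i < n]
       [tuple ratr (tnth q.1 i) + q.2.+1%:R^-1 | i < n].
pose F q := if `[< box q `<=` tup2rv @^-1` U >] then box q else set0.
rewrite (_ : _ @^-1` U = \bigcup_q F q); last first.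
  apply/seteqP; split => [t /= Ut|t [q _]]; last first.
    by rewrite /F; case: asboolP => // h /h.
  have /nbhs_ballP[e /= e0 eU] := oU _ Ut.
  (* With half-side [d < e / 2] and a rational centre within [d] of [t], the box contains [t] and
     stays within [d + d < e] of it. *)
  have [m me] : exists m, m.+1%:R^-1 < e / 2 :> R.
    have /cvgrPdist_lt /(_ (e / 2)) := @cvg_harmonic R.
    case; first by rewrite divr_gt0.
    move=> m _ /(_ m (leqnn m)) /=; rewrite sub0r normrN ger0_norm//; first by exists m.
  have [d [dE d0]] : exists d : R, d = m.+1%:R^-1 /\ 0 < d.
    by exists m.+1%:R^-1; rewrite invr_gt0.
  rewrite -dE in me.
  have qP i : exists q : rat, `|tnth t i - ratr q| < d.
    have [|q] := @rat_in_itvoo R (tnth t i - d) (tnth t i + d); first by lra.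
    rewrite in_itv /= => /andP[q1 q2]; exists q.
    by rewrite ltr_norml; apply/andP; split; lra.
  have [q hq] := choice qP.
  have qE i : tnth [tuple q i | i < n] i = q i by rewrite tnth_mktuple.
  exists ([tuple q i | i < n], m) => //.
  rewrite /F; case: asboolP => [_|].
    move=> i /=; rewrite !tnth_mktuple /= -dE; have := hq i.
    by rewrite ltr_norml => /andP[? ?]; apply/andP; split; lra.
  case=> s hs /=; apply: eU; rewrite -ball_normE /=.
  apply: (@le_lt_trans _ _ (d + d)); last by lra.
  apply: norm_le_coord => [|i]; first by lra.
  have := hs i; rewrite !mxE !tnth_mktuple /= -dE => /andP[? ?].
  have := hq i; rewrite ltr_norml => /andP[? ?].
  by rewrite ler_norml; apply/andP; split; lra.
apply: countable_bigcupT_measurable; first exact: countableP.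
move=> q; rewrite /F; case: asboolP => _; last exact: measurable0.
exact: measurable_tbox.
Qed.

Lemma continuous_measurable_tup2rv h : continuous h ->
  measurable_fun setT (h \o tup2rv).
Proof.
move=> /continuousP ch; apply: (measurability (@RGenOpens.G R)).
  exact: RGenOpens.measurableE.
move=> _ [_ [a [b ->]] <-]; rewrite setTI comp_preimage.
by apply: measurable_tup2rv_open; apply: ch; exact: interval_open.
Qed.

Lemma continuous_bounded_support h r : continuous h ->
  (forall x, r < `|x| -> h x = 0) ->
  exists2 M, 0 <= M & forall x, `|h x| <= M.
Proof.
move=> ch h0.
have cB : compact [set x : 'rV[R]_n | `|x| <= r].
  apply: bounded_closed_compact.
    exists r; split; first exact: num_real.
    by move=> M rM x /= /le_trans; apply; exact: ltW.
  have -> : [set x : 'rV[R]_n | `|x| <= r] = Num.norm @^-1` [set y | y <= r] by [].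
  by apply: closed_comp; [move=> x _; exact: norm_continuous|exact: closed_le].
have /compact_bounded[M [_ hM]] : compact (h @` [set x | `|x| <= r]).
  apply: continuous_compact => //; exact: continuous_subspaceT.
exists (`|M| + 1); first by rewrite addr_ge0.
move=> x; have [xr|xr] := leP `|x| r; last by rewrite h0// normr0 addr_ge0.
apply: (hM (`|M| + 1)); last by exists x.
by rewrite ltr_pwDr// ler_norm.
Qed.

End RowVectors.

(** * Integrability of bounded functions with bounded support *)

Section Integration.
Context {R : realType} {n : nat}.
Variables (mu : {measure set (n.-tuple R) -> \bar R}) (hmu : is_lebesgue_Rn mu).
Implicit Types (x v : 'rV[R]_n) (h : 'rV[R]_n -> R).

Lemma bounded_support_integrable (g : n.-tuple R -> R) (r M : R) :
  measurable_fun setT g -> (forall t, `|g t| <= M) ->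
  (forall t, r < `|tup2rv t| -> g t = 0) ->
  mu.-integrable setT (EFin \o g).
Proof.
move=> mg gM g0; pose A := @tbox R n (tconst (- r)) (tconst r).
have mA : measurable A by exact: measurable_tbox.
have -> : EFin \o g = (EFin \o g) \_ A.
  apply/funext => t; rewrite /patch; case: ifPn => // tA /=.
  have [tr|/g0 -> //] := leP `|tup2rv t| r.
  by have := tup2rv_box tr; move/mem_set; rewrite (negbTE tA).
apply: (integrable_mkcond _ mA).1; apply: measurable_bounded_integrable => //.
- exact: tbox_measure_lty.
- exact: measurable_funTS.
- exists M; split; first exact: num_real.
  by move=> K MK t _ /=; exact: le_trans (gM t) (ltW MK).
Qed.

Lemma continuous_support_integrable h r : continuous h ->
  (forall x, r < `|x| -> h x = 0) ->
  mu.-integrable setT (fun t => (h (tup2rv t))%:E).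
Proof.
move=> ch h0; have [M _ hM] := continuous_bounded_support ch h0.
apply: (@bounded_support_integrable (h \o tup2rv) r M) => [|t|t /h0//].
  exact: continuous_measurable_tup2rv.
exact: hM.
Qed.

End Integration.

(** * Integration by parts *)

Section IntegrationByParts.
Context {R : realType} {n : nat}.
Variables (mu : {measure set (n.-tuple R) -> \bar R}) (hmu : is_lebesgue_Rn mu).
Implicit Types (x v : 'rV[R]_n) (h : 'rV[R]_n -> R).

Lemma derivable_line h v x : (forall y, derivable h y v) ->
  forall s : R, is_derive s 1 (fun t : R => h (t *: v + x)) ('D_v h (s *: v + x)).
Proof.
move=> dh s; have dv := dh (s *: v + x).
have E : (fun k : R => k^-1 *: (((fun t : R => h (t *: v + x)) \o shift s) (k *: 1)
     - h (s *: v + x))) =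
   (fun k : R => k^-1 *: ((h \o shift (s *: v + x)) (k *: v) - h (s *: v + x))).
  by apply/funext => k /=; rewrite [k *: 1]mulr1 scalerDl addrA.
by apply: DeriveDef; rewrite /derivable /derive E.
Qed.

(** The mean value theorem along the line through [x] in direction [v]. It bounds the difference
    quotients of [h] uniformly in the step, as dominated convergence requires. *)
Lemma increment_le h v x (M t : R) : (forall y, derivable h y v) ->
  (forall y, `|'D_v h y| <= M) -> 0 <= t -> `|h (t *: v + x) - h x| <= M * t.
Proof.
move=> dh hM t0; have dl := derivable_line x dh.
have cl : {within `[0, t], continuous (fun s : R => h (s *: v + x))}.
  apply: derivable_within_continuous => s _.
  by have [] := dl s.
have [c _] := @MVT_segment R (fun t : R => h (t *: v + x))
   (fun s => 'D_v h (s *: v + x)) 0 t t0 (fun s _ => dl s) cl.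
rewrite scale0r add0r subr0 => ->.
by rewrite normrM (ger0_norm t0) ler_wpM2r.
Qed.

Lemma derive_support h v r : (forall x, r < `|x| -> h x = 0) ->
  forall x, r < `|x| -> 'D_v h x = 0.
Proof.
move=> h0 x rx.
rewrite -[RHS](derive_cst (0 : R) x v); apply: near_eq_derive.
have /nbhs_ballP[e /= e0 he] : nbhs x [set y : 'rV[R]_n | r < `|y|].
  by have := lt_nbhsr rx => /(@norm_continuous _ _ x).
by apply/nbhs_ballP; exists e => // y /he /h0.
Qed.

(** Dominated convergence, the dominating function being [M] on a cube that contains the ball of
    radius [r]. *)
Lemma bounded_support_cvg (q : nat -> 'rV[R]_n -> R) h (r M : R) :
  (forall m, measurable_fun setT (q m \o tup2rv)) ->
  (forall m x, `|q m x| <= M) -> (forall m x, r < `|x| -> q m x = 0) ->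
  (forall x, q m x @[m --> \oo] --> h x) ->
  (\int[mu]_t (q m (tup2rv t))%:E @[m --> \oo] -->
   \int[mu]_t (h (tup2rv t))%:E)%E.
Proof.
move=> mq qM q0 qh; pose A := @tbox R n (tconst (- r)) (tconst r).
have mA : measurable A by exact: measurable_tbox.
have iM : mu.-integrable setT (EFin \o (cst M \_ A)).
  rewrite -restrict_EFin.
  apply: (integrable_mkcond _ mA).1; apply: measurable_bounded_integrable => //.
  - exact: tbox_measure_lty.
  - exists M; split; first exact: num_real.
    by move=> K MK t _ /=; rewrite ger0_norm ?(ltW MK)// (le_trans _ (qM 0%N 0)).
apply: (@dominated_cvg _ _ _ mu setT measurableT
  (fun m t => (q m (tup2rv t))%:E) (fun t => (h (tup2rv t))%:E)
  (EFin \o (cst M \_ A))) => //.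
- by move=> m; apply/measurable_EFinP; exact: mq.
- by move=> t _; apply/cvg_EFin; [exact: nearW|exact: qh].
- move=> m t _ /=; rewrite lee_fin /patch; case: ifPn => [_|tA]; first exact: qM.
  have [tr|/q0 ->] := leP `|tup2rv t| r; last by rewrite normr0.
  by have := tup2rv_box tr; move/mem_set; rewrite (negbTE tA).
Qed.

Lemma integral_derive_eq0 h v r : continuous h -> (forall x, derivable h x v) ->
  continuous ('D_v h) -> (forall x, r < `|x| -> h x = 0) ->
  (\int[mu]_t ('D_v h (tup2rv t))%:E = 0)%E.
Proof.
move=> ch dh cdh h0.
have dh0 := derive_support v h0.
have [M M0 hM] := continuous_bounded_support cdh dh0.
(* Difference quotients with step [1/(m+1)]: each has integral zero by translation invariance, they
   are bounded by [M], and they converge pointwise to the derivative. *)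
pose q m x := m.+1%:R * (h ((m.+1%:R^-1 : R) *: v + x) - h x).
have m0 m : (0 : R) <= m.+1%:R^-1 by rewrite invr_ge0.
have m1 m : (m.+1%:R^-1 : R) <= 1 by rewrite invf_le1 ?ler1n.
have ct m : continuous (fun x => h ((m.+1%:R^-1 : R) *: v + x)).
  move=> x; apply: (@continuous_comp _ _ _ (fun x => (m.+1%:R^-1 : R) *: v + x) h).
    apply: (@continuousD _ _ _ (cst ((m.+1%:R^-1 : R) *: v)) id) => //.
    exact: cst_continuous.
  exact: ch.
(* The translations have length at most [|v|], so [r + |v|] is a common support radius for all the
   quotients. *)
have t0 m x : r + `|v| < `|x| -> h ((m.+1%:R^-1 : R) *: v + x) = 0.
  move=> rx; apply: h0; set w := _ *: v.
  have wv : `|w| <= `|v| by rewrite normrZ (ger0_norm (m0 m)) ler_piMl.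
  have : `|x| <= `|w + x| + `|w| by rewrite -{1}(addKr w x) addrC ler_normB.
  by lra.
have h0' x : r + `|v| < `|x| -> h x = 0.
  by move=> rx; apply: h0; apply: le_lt_trans rx; rewrite lerDl.
have mq m : measurable_fun setT (q m \o tup2rv).
  apply: continuous_measurable_tup2rv => x.
  apply: (@continuousM _ _ (cst m.+1%:R)
    (fun x => h ((m.+1%:R^-1 : R) *: v + x) - h x)); first exact: cst_continuous.
  by apply: (@continuousB _ _ _ (fun x => h ((m.+1%:R^-1 : R) *: v + x)) h);
    [exact: ct|exact: ch].
have qM m x : `|q m x| <= M.
  rewrite normrM ger0_norm// mulrC -ler_pdivlMr ?ltr0n//.
  exact: increment_le.
have q0 m x : r + `|v| < `|x| -> q m x = 0.
  by move=> rx; rewrite /q t0// h0'// subrr mulr0.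
have qcvg x : q m x @[m --> \oo] --> 'D_v h x.
  have hd : k^-1 *: ((h \o shift x) (k *: v) - h x) @[k --> 0^'] --> 'D_v h x.
    exact: dh.
  (* The derivative is a limit along punctured neighbourhoods of 0, and the steps [1/(m+1)] never
     vanish. *)
  have H : (m.+1%:R^-1 : R) @[m --> \oo] --> (0 : R)^'.
    move=> B B0; have {}B0 : nbhs (0 : R) (fun y => y != 0 -> B y) := B0.
    have : \forall m \near \oo, (harmonic m : R) != 0 -> B (harmonic m).
      exact: (cvg_harmonic B0).
    by apply: filterS => m; apply; rewrite /= invr_eq0 pnatr_eq0.
  have := cvg_comp _ _ H hd; apply: cvg_trans.
  by apply: near_eq_cvg; apply: nearW => m /=; rewrite invrK.
have Iq m : (\int[mu]_t (q m (tup2rv t))%:E = 0)%E.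
  have i1 := continuous_support_integrable hmu ch h0.
  have [i2 e2] := integral_tshift hmu (m.+1%:R^-1 *: v) i1.
  have -> : (fun t => (q m (tup2rv t))%:E) = (fun t => m.+1%:R%:E *
     ((h (tup2rv (tshift ((m.+1%:R^-1 : R) *: v) t)))%:E - (h (tup2rv t))%:E))%E.
    by apply/funext => t; rewrite tup2rv_tshift /q [tup2rv t + _]addrC.
  rewrite integralZl//; last exact: integrableB.
  by rewrite integralB// e2 subee ?mule0// integrable_fin_num.
have := bounded_support_cvg mq qM q0 qcvg.
by under eq_fun do rewrite Iq; move/cvg_unique => /(_ _ _ (cvg_cst _)) ->.
Qed.

(** The product [psi * phi] inherits the bounded support of [phi], so its derivative has integral
    zero; the Leibniz rule splits that integral in two. *)
Lemma integration_by_parts (psi phi : 'rV[R]_n -> R) v r :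
  continuous psi -> (forall x, derivable psi x v) -> continuous ('D_v psi) ->
  continuous phi -> (forall x, derivable phi x v) -> continuous ('D_v phi) ->
  (forall x, r < `|x| -> phi x = 0) ->
  (\int[mu]_t (psi (tup2rv t) * 'D_v phi (tup2rv t))%:E =
   - \int[mu]_t ('D_v psi (tup2rv t) * phi (tup2rv t))%:E)%E.
Proof.
move=> c1 d1 e1 c2 d2 e2 phi0.
have dphi0 := derive_support v phi0.
have DM x : 'D_v (psi * phi) x = psi x * 'D_v phi x + 'D_v psi x * phi x.
  by rewrite deriveM//; congr (_ + _); exact: mulrC.
have ca : continuous (fun x => psi x * 'D_v phi x).
  by move=> x; apply: (@continuousM _ _ psi ('D_v phi)); [exact: c1|exact: e2].
have cb : continuous (fun x => 'D_v psi x * phi x).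
  by move=> x; apply: (@continuousM _ _ ('D_v psi) phi); [exact: e1|exact: c2].
have ia : mu.-integrable setT (fun t => (psi (tup2rv t) * 'D_v phi (tup2rv t))%:E).
  apply: (continuous_support_integrable hmu ca (r := r)) => x rx.
  by rewrite dphi0// mulr0.
have ib : mu.-integrable setT (fun t => ('D_v psi (tup2rv t) * phi (tup2rv t))%:E).
  apply: (continuous_support_integrable hmu cb (r := r)) => x rx.
  by rewrite phi0// mulr0.
have : (\int[mu]_t ('D_v (psi * phi) (tup2rv t))%:E = 0)%E.
  apply: (@integral_derive_eq0 _ _ r).
  - by move=> x; apply: (@continuousM _ _ psi phi); [exact: c1|exact: c2].
  - by move=> x; exact: derivableM.
  - have -> : 'D_v (psi * phi) = (fun x => psi x * 'D_v phi x) + (fun x => 'D_v psi x * phi x).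
      exact/funext.
    by move=> x; apply: continuousD; [exact: ca|exact: cb].
  - by move=> x rx; rewrite -[LHS]/(psi x * phi x) phi0// mulr0.
under eq_integral do rewrite DM EFinD.
rewrite integralD//.
(* Both integrals are finite, so the vanishing sum can be rearranged among real numbers. *)
have := integrable_fin_num measurableT ia; have := integrable_fin_num measurableT ib.
move=> /fineK <- /fineK <-; rewrite -EFinD -EFinN => -[] /eqP.
by rewrite addr_eq0 => /eqP ->.
Qed.

End IntegrationByParts.

(** * Bump functions *)

Section Ramp.
Context {R : realType}.
Implicit Types s t : R.

Definition pospart t : R := Num.max 0 t.
Definition sqpos t : R := pospart t ^+ 2.

Lemma pospartE t : pospart t = if 0 <= t then t else 0.
Proof. by rewrite /pospart; case: ifPn => t0; [rewrite max_r|rewrite max_l // ltW // ltNge]. Qed.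

Lemma pospart_continuous : continuous pospart.
Proof.
move=> t; apply: (@continuous_max _ _ (cst 0) id) => //.
exact: cst_continuous.
Qed.

(** The difference quotient differs from [d] by at most [C * |h|]. This handles [sqpos] at the point
    0, where its two formulas meet, as well as the quadratic [bumparg] along a line. *)
Lemma is_derive_quadratic_remainder (F : R -> R) t d C : 0 < C ->
  (forall h : R, `|F (h + t) - F t - d * h| <= C * h ^+ 2) -> is_derive t 1 F d.
Proof.
move=> C0 H.
have E : h^-1 *: ((F \o shift t) (h *: 1) - F t) @[h --> 0^'] --> d.
  apply/cvgrPdist_le => e e0.
  near=> h.
  have h0 : h != 0 by near: h; exact: nbhs_dnbhs_neq.
  have he : C * `|h| <= e.
    rewrite -ler_pdivlMl//; near: h; apply: cvg_within; apply/nbhs_ballP.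
    exists (C^-1 * e) => /=; first by rewrite mulr_gt0 ?invr_gt0.
    by move=> h; rewrite -ball_normE /= sub0r normrN => /ltW.
  rewrite distrC /= [h *: 1]mulr1; apply: le_trans he.
  rewrite -(ler_pM2l (x := `|h|)) ?normr_gt0// -normrM mulrCA -expr2 real_normK ?num_real//.
  apply: le_trans (H h); rewrite le_eqVlt; apply/orP; left; apply/eqP; congr (`|_|).
  rewrite -[_ *: _]/(h^-1 * _); field.
  exact: h0.
apply: DeriveDef; last exact: cvg_lim E.
by apply/cvg_ex; eexists; exact: E.
Unshelve. all: by end_near. Qed.

Lemma is_derive_sqpos t : is_derive t 1 sqpos (2 * pospart t).
Proof.
apply: (@is_derive_quadratic_remainder _ _ _ 1) => // h.
rewrite mul1r ler_norml /sqpos !pospartE.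
(* Each sign pattern of [t] and [h + t] leaves a polynomial inequality. *)
by case: ifPn; case: ifPn; rewrite -?ltNge => *; apply/andP; split; nra.
Qed.

(* A [C^1] function equal to 1 on the negative reals and to 0 beyond 1. *)
Definition ramp t : R := sqpos (1 - sqpos t).
Definition dramp t : R := - (4 * pospart (1 - sqpos t) * pospart t).

Lemma is_derive_ramp t : is_derive t 1 ramp (dramp t).
Proof.
have h1 := is_derive_sqpos (1 - sqpos t).
have h2 : is_derive t 1 (fun s => 1 - sqpos s) (0 - 2 * pospart t).
  by apply: is_deriveB; exact: is_derive_sqpos.
have := @is_derive1_comp _ sqpos (fun s => 1 - sqpos s) t _ _ h1 h2.
rewrite (_ : _ * _ = dramp t)//.
by rewrite /dramp; ring.
Qed.

Lemma pospart_ge0 t : 0 <= pospart t.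
Proof. by rewrite le_max lexx. Qed.

Lemma ramp_le0 t : t <= 0 -> ramp t = 1.
Proof. by move=> t0; rewrite /ramp /sqpos /pospart (max_l t0) expr0n subr0 max_r// expr1n. Qed.

Lemma ramp_ge1 t : 1 <= t -> ramp t = 0 /\ dramp t = 0.
Proof.
move=> t1; suff E : pospart (1 - sqpos t) = 0.
  by rewrite /ramp /dramp {1}/sqpos E expr0n mulr0 mul0r oppr0.
rewrite /sqpos /pospart (@max_r _ _ 0 t) ?max_l//; last by lra.
by rewrite subr_le0; nra.
Qed.

Lemma ramp_bound t : `|ramp t| <= 1 /\ `|dramp t| <= 4.
Proof.
have [t1|t1] := leP 1 t; first by have [-> ->] := ramp_ge1 t1; rewrite normr0.
have p0 := pospart_ge0 t; have p1 : pospart t <= 1 by rewrite ge_max ler01 ltW.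
have q0 := pospart_ge0 (1 - sqpos t).
have q1 : pospart (1 - sqpos t) <= 1.
  by rewrite ge_max ler01 lerBlDr lerDl sqr_ge0.
rewrite normrN /ramp /sqpos -/(sqpos t) !ger0_norm ?sqr_ge0//; last first.
  by rewrite !mulr_ge0.
by split; nra.
Qed.

End Ramp.

Lemma derive_continuous (R : realType) (F dF : R -> R) :
  (forall t : R, is_derive t 1 F (dF t)) -> continuous F.
Proof.
move=> dFt t; apply/differentiable_continuous/derivable1_diffP.
by have [] := dFt t.
Qed.

Lemma ramp_continuous (R : realType) : continuous (@ramp R).
Proof. exact: (derive_continuous (@is_derive_ramp R)). Qed.

Lemma dramp_continuous (R : realType) : continuous (@dramp R).
Proof.
move=> t; have c1 := @pospart_continuous R.
have c2 : continuous (fun s : R => pospart (1 - sqpos s)).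
  move=> s; apply: (@continuous_comp _ _ _ (fun s : R => 1 - sqpos s) (@pospart R)); last exact: c1.
  apply: (@continuousB _ _ _ (cst (1 : R)) (@sqpos R)); first exact: cst_continuous.
  exact: (derive_continuous (@is_derive_sqpos R)).
apply: (@continuousN _ _ _ (fun t : R => 4 * pospart (1 - sqpos t) * pospart t)).
apply: (@continuousM _ _ (fun t : R => 4 * pospart (1 - sqpos t)) (@pospart R)); last exact: c1.
apply: (@continuousM _ _ (cst (4 : R)) (fun t : R => pospart (1 - sqpos t))); first exact: cst_continuous.
exact: c2.
Qed.

Section Bump.
Context {R : realType} {n : nat}.
Variables (c : 'rV[R]_n) (rho : R) (rho0 : 0 < rho).
Implicit Types x : 'rV[R]_n.

(* Chosen so that [bumparg x <= 0] means [|x - c|^2 <= rho^2 / 2] and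
   [bumparg x < 1] means [|x - c| < rho], for the Euclidean norm. *)
Definition bumparg x : R := 2 / rho ^+ 2 * (\sum_j (x 0 j - c 0 j) ^+ 2) - 1.
Definition bump x : R := ramp (bumparg x).
Definition dbump (i : 'I_n) x : R :=
  dramp (bumparg x) * (4 / rho ^+ 2 * (x 0 i - c 0 i)).

Lemma bumparg_continuous : continuous bumparg.
Proof.
have ci j : continuous (fun x => x 0 j - c 0 j).
  move=> x; apply: (@continuousB _ _ _ (fun x : 'rV[R]_n => x 0 j) (cst (c 0 j))).
    exact: coord_continuous.
  exact: cst_continuous.
have cs : continuous (fun x => \sum_j (x 0 j - c 0 j) ^+ 2).
  apply: continuous_big => [|j _ y]; first exact: add_continuous.
  by apply: (@continuousM _ _ (fun x => x 0 j - c 0 j) (fun x => x 0 j - c 0 j)); exact: ci.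
move=> x; apply: (@continuousB _ _ _ (fun x => 2 / rho ^+ 2 * (\sum_j (x 0 j - c 0 j) ^+ 2)) (cst 1)).
  apply: (@continuousM _ _ (cst (2 / rho ^+ 2)) (fun x => \sum_j (x 0 j - c 0 j) ^+ 2)); last exact: cs.
  exact: cst_continuous.
exact: cst_continuous.
Qed.

Lemma bump_continuous : continuous bump.
Proof.
move=> x; apply: (@continuous_comp _ _ _ bumparg (@ramp R)).
  exact: bumparg_continuous.
exact: ramp_continuous.
Qed.

Lemma dbump_continuous i : continuous (dbump i).
Proof.
move=> x; apply: (@continuousM _ _ (dramp \o bumparg) (fun x => 4 / rho ^+ 2 * (x 0 i - c 0 i))).
  apply: (@continuous_comp _ _ _ bumparg (@dramp R)).
    exact: bumparg_continuous.
  exact: dramp_continuous.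
apply: (@continuousM _ _ (cst (4 / rho ^+ 2)) (fun x => x 0 i - c 0 i)).
  exact: cst_continuous.
apply: (@continuousB _ _ _ (fun x : 'rV[R]_n => x 0 i) (cst (c 0 i))).
  exact: coord_continuous.
exact: cst_continuous.
Qed.

Lemma bumparg_line i x (t : R) : bumparg (t *: ev i + x) =
  bumparg x + (4 / rho ^+ 2 * (x 0 i - c 0 i)) * t + 2 / rho ^+ 2 * t ^+ 2.
Proof.
rewrite /bumparg (bigD1 i)//= [X in _ = _ * X - 1 + _ + _](bigD1 i)//=.
rewrite (eq_bigr (fun j => (x 0 j - c 0 j) ^+ 2)) => [|j ji]; last first.
  by rewrite !mxE (negbTE ji) andbF mulr0 add0r.
by rewrite !mxE !eqxx /= mulr1; field; rewrite gt_eqF.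
Qed.

(** On the line through [x] in direction [ev i], [bumparg] is a quadratic polynomial in the
    parameter, so the one-variable chain rule at parameter 0 applies. The difference quotients on
    the line are those of the directional derivative. *)
Lemma is_derive_bump i x : is_derive x (ev i) bump (dbump i x).
Proof.
set a := 4 / rho ^+ 2 * (x 0 i - c 0 i).
have h2 : is_derive (0 : R) 1 (fun t : R => bumparg x + a * t + 2 / rho ^+ 2 * t ^+ 2) a.
  apply: (@is_derive_quadratic_remainder _ _ _ _ (2 / rho ^+ 2)) => [|h].
    by rewrite divr_gt0 ?exprn_gt0.
  have p0 : 0 <= 2 / rho ^+ 2 * h ^+ 2 by rewrite mulr_ge0 ?divr_ge0 ?sqr_ge0.
  rewrite [X in `|X|](_ : _ = 2 / rho ^+ 2 * h ^+ 2); last by ring.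
  by rewrite ger0_norm.
have h1 : is_derive (bumparg x + a * 0 + 2 / rho ^+ 2 * 0 ^+ 2) 1 (@ramp R) (dramp (bumparg x)).
  by rewrite mulr0 expr0n mulr0 !addr0; exact: is_derive_ramp.
have := @is_derive1_comp _ (@ramp R)
  (fun t : R => bumparg x + a * t + 2 / rho ^+ 2 * t ^+ 2) _ _ _ h1 h2.
have -> : @ramp R \o (fun t : R => bumparg x + a * t + 2 / rho ^+ 2 * t ^+ 2) =
    (fun t : R => bump (t *: ev i + x)).
  by apply/funext => t /=; rewrite /bump bumparg_line.
rewrite /dbump -/a.
have E : (fun k : R => k^-1 *: (((fun t : R => bump (t *: ev i + x)) \o shift 0) (k *: 1)
     - bump (0 *: ev i + x))) =
   (fun k : R => k^-1 *: ((bump \o shift x) (k *: ev i) - bump x)).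
  by apply/funext => k /=; rewrite [k *: 1]mulr1 addr0 scale0r add0r.
by case; rewrite /derivable /derive E => *; apply: DeriveDef.
Qed.

Lemma bumparg_box x : bumparg x < 1 -> forall j, `|x 0 j - c 0 j| < rho.
Proof.
move=> h j; rewrite -ltr_sqr ?nnegrE ?(ltW rho0)//.
rewrite real_normK ?num_real//.
have : (x 0 j - c 0 j) ^+ 2 <= \sum_j (x 0 j - c 0 j) ^+ 2.
  by rewrite (bigD1 j)//= lerDl sumr_ge0// => k _; exact: sqr_ge0.
move/le_lt_trans; apply; move: h; rewrite /bumparg.
set S := \sum_j _; rewrite ltrBlDr mulrAC ltr_pdivrMr ?exprn_gt0//.
by lra.
Qed.

Lemma bump_support x j : rho <= `|x 0 j - c 0 j| -> bump x = 0 /\ forall i, dbump i x = 0.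
Proof.
move=> h; have [/ramp_ge1[r0 d0]|/bumparg_box/(_ j)] := leP 1 (bumparg x).
  by split => [//|i]; rewrite /dbump d0 mul0r.
by rewrite ltNge h.
Qed.

Lemma bump_le1 x : `|bump x| <= 1.
Proof. by have [] := ramp_bound (bumparg x). Qed.

Lemma dbump_le i x : `|dbump i x| <= 16 / rho.
Proof.
have [/ramp_ge1[r0 d0]|/bumparg_box/(_ i) h] := leP 1 (bumparg x).
  by rewrite /dbump d0 mul0r normr0 divr_ge0// ltW.
rewrite /dbump normrM; have [_ d4] := ramp_bound (bumparg x).
(* The first factor bounds [dramp]; the second bounds the partial derivative of [bumparg] where
   [|x_i - c_i| < rho]. *)
have -> : 16 / rho = 4 * (4 / rho ^+ 2 * rho) by field; rewrite gt_eqF.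
have p4 : 0 <= 4 / rho ^+ 2 by rewrite divr_ge0 ?sqr_ge0.
apply: ler_pM => //; rewrite normrM (ger0_norm p4).
by rewrite ler_wpM2l// ltW.
Qed.

(** On this cube the squared Euclidean distance to [c] is at most [n (rho / 2n)^2 = rho^2 / 4n],
    below the threshold [rho^2 / 2]. A plateau of positive measure is what later detects the value
    [b]. *)
Lemma bump_eq1 x : (forall j, `|x 0 j - c 0 j| <= rho / (2 * n%:R)) -> bump x = 1.
Proof.
move=> h; apply: ramp_le0; rewrite /bumparg subr_le0.
have S : \sum_j (x 0 j - c 0 j) ^+ 2 <= n%:R * (rho / (2 * n%:R)) ^+ 2.
  rewrite -[n in n%:R * _]card_ord -sumr_const mulr_suml; apply: ler_sum => j _.
  by rewrite mul1r -real_normK ?num_real// ler_sqr ?nnegrE// (le_trans _ (h j)).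
have [n0|n0] := posnP n.
  have nn : n%:R = 0 :> R by rewrite n0.
  move: S; rewrite nn mul0r => S; apply: (@le_trans _ _ 0) => //.
  by rewrite mulr_ge0_le0// divr_ge0 ?sqr_ge0.
have n1 : 1 <= n%:R :> R by rewrite ler1n.
apply: (@le_trans _ _ (2 / rho ^+ 2 * (n%:R * (rho / (2 * n%:R)) ^+ 2))).
  by rewrite ler_wpM2l// divr_ge0 ?sqr_ge0.
have -> : 2 / rho ^+ 2 * (n%:R * (rho / (2 * n%:R)) ^+ 2) = (2 * n%:R)^-1.
  by field; rewrite !gt_eqF// (lt_le_trans _ n1).
by rewrite invf_le1 ?mulr_gt0//; lra.
Qed.

End Bump.

(** * Sums of functions with disjoint supports *)

Section DisjointSum.
Context {R : realType} {T : Type}.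
Variable a : nat -> T -> R.
Hypothesis disj : forall x j k, a j x != 0 -> a k x != 0 -> j = k.

(* At every point the partial sums are eventually constant. *)
Definition dsum (x : T) : R := limn (fun K => \sum_(k < K) a k x).

(** At most one term is nonzero at [x]. Its index is [k]; if all terms vanish, [k = 0] serves.
    Pointwise questions about the sum thereby reduce to a single term. *)
Lemma dsum_spec x : exists k, dsum x = a k x /\
  forall K, \sum_(j < K) a j x = if (k < K)%N then a k x else 0.
Proof.
have [k sk] : exists k, forall K, \sum_(j < K) a j x = if (k < K)%N then a k x else 0.
  have [[k ak]|/forallNP a0] := pselect (exists k, a k x != 0).
    have aj j : j != k -> a j x = 0.
      by apply: contraNeq => aj; apply/eqP; exact: disj aj ak.
    exists k => K; case: ifPn => kK.
      rewrite (bigD1 (Ordinal kK))//= big1 ?addr0// => j jk; apply: aj.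
      exact: contra jk => /eqP jk; apply/eqP/val_inj.
    rewrite big1// => j _; apply: aj; apply: contra kK => /eqP <-; exact: ltn_ord.
  have a0' j : a j x = 0 by apply/eqP; apply/negPn/negP; exact: a0.
  by exists 0%N => K; rewrite a0' if_same big1.
exists k; split => //; apply: cvg_lim => //.
have : (fun K => \sum_(j < K) a j x) @ \oo --> a k x.
  apply: (@cvg_trans _ (cst (a k x) @ \oo)); last exact: cvg_cst.
  apply: near_eq_cvg; near=> K; rewrite sk.
  by have -> : (k < K)%N by near: K; exact: nbhs_infty_gt.
exact.
Unshelve. all: by end_near. Qed.

Lemma dsum_cvg x : \sum_(k < K) a k x @[K --> \oo] --> dsum x.
Proof.
have [k [-> sk]] := dsum_spec x.
apply: (@cvg_trans _ (cst (a k x) @ \oo)); last exact: cvg_cst.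
apply: near_eq_cvg; near=> K; rewrite sk.
by have -> : (k < K)%N by near: K; exact: nbhs_infty_gt.
Unshelve. all: by end_near. Qed.

(** A partial sum is either the full sum or zero, so the limit itself dominates the partial sums. *)
Lemma psum_le_dsum K x : `|\sum_(k < K) a k x| <= `|dsum x|.
Proof.
have [k [-> ->]] := dsum_spec x; case: ifPn => // _.
by rewrite normr0.
Qed.

End DisjointSum.

(** * The accumulating spikes *)

Section Spikes.
Context {R : realType} {n : nat}.
Variables (mu : {measure set (n.-tuple R) -> \bar R}) (hmu : is_lebesgue_Rn mu).
Variables (p : 'rV[R]_n) (b : R) (i0 : 'I_n).
Hypothesis n2 : (2 < n)%N.
Implicit Types x : 'rV[R]_n.

Definition rad (k : nat) : R := 2^-1 ^+ k.
(** The factor 3 places the spike in the slab where coordinate [i0] exceeds that of [p] by an amount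
    between [2 * rad k] and [4 * rad k]; these dyadic slabs are disjoint. *)
Definition ctr (k : nat) : 'rV[R]_n := p + (3 * rad k) *: ev i0.
Definition spike k x : R := b * bump (ctr k) (rad k) x.
Definition dspike i k x : R := b * dbump (ctr k) (rad k) i x.
Definition spikes : 'rV[R]_n -> R := dsum spike.
Definition dspikes i : 'rV[R]_n -> R := dsum (dspike i).

Lemma rad_gt0 k : 0 < rad k. Proof. by rewrite exprn_gt0// invr_gt0. Qed.

Lemma rad_le1 k : rad k <= 1.
Proof. by rewrite exprn_ile1// ?invr_ge0// invf_le1// ler1n. Qed.

Lemma rad_half j k : (j < k)%N -> 2 * rad k <= rad j.
Proof.
move=> jk; rewrite /rad -(subnKC jk) addSn exprS mulrA divff// mul1r exprD.
by rewrite -/(rad _) -/(rad _) ler_piMr ?rad_le1// ltW// rad_gt0.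
Qed.

Lemma spike_support k x j : rad k <= `|x 0 j - ctr k 0 j| ->
  spike k x = 0 /\ forall i, dspike i k x = 0.
Proof.
move=> h; have [e1 e2] := bump_support (rad_gt0 k) h.
by split => [|i]; rewrite /spike /dspike ?e1 ?e2 mulr0.
Qed.

Lemma ctr_slab k x : `|x 0 i0 - ctr k 0 i0| < rad k ->
  2 * rad k < x 0 i0 - p 0 i0 < 4 * rad k.
Proof.
by rewrite /ctr !mxE !eqxx mulr1 ltr_norml => /andP[? ?]; apply/andP; split; lra.
Qed.

(** For [j < k], the upper end [4 * rad k] of one slab does not exceed the lower end [2 * rad j] of
    the other. *)
Lemma slab_disjoint x j k : `|x 0 i0 - ctr k 0 i0| < rad k ->
  `|x 0 i0 - ctr j 0 i0| < rad j -> j = k.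
Proof.
wlog jk : j k / (j < k)%N.
  move=> H h1 h2; have [jk|kj|//] := ltngtP j k; first exact: H.
  by apply/esym; exact: H.
move=> /ctr_slab/andP[a1 a2] /ctr_slab/andP[b1 b2].
by have := rad_half jk => h; exfalso; lra.
Qed.

Lemma spike_disj x j k : spike j x != 0 -> spike k x != 0 -> j = k.
Proof.
move=> sj sk; apply: (@slab_disjoint x); rewrite ltNge; apply/negP => /spike_support[e _].
  by rewrite e eqxx in sk.
by rewrite e eqxx in sj.
Qed.

Lemma dspike_disj i x j k : dspike i j x != 0 -> dspike i k x != 0 -> j = k.
Proof.
move=> sj sk; apply: (@slab_disjoint x); rewrite ltNge; apply/negP => /spike_support[_ e].
  by rewrite e eqxx in sk.
by rewrite e eqxx in sj.
Qed.

Lemma spikes_le x : `|spikes x| <= `|b|.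
Proof.
rewrite /spikes; have [k [-> _]] := dsum_spec (@spike_disj) x.
by rewrite /spike normrM ler_piMr// bump_le1.
Qed.

(** Centres lie within 3 of [p] and radii are at most 1, which gives one bound for all the
    supports. *)
Lemma ctr_far k x : `|p| + 4 < `|x| -> exists j, rad k <= `|x 0 j - ctr k 0 j|.
Proof.
move=> px; apply/not_existsP => H.
have : `|x - ctr k| <= 1.
  apply: norm_le_coord => // j; rewrite mxE [X in _ + X]mxE.
  have := H j => /negP; rewrite -ltNge.
  by move=> /ltW/le_trans; apply; exact: rad_le1.
have : `|ctr k| <= `|p| + 3.
  apply: (le_trans (ler_normD _ _)); rewrite lerD2l normrZ.
  have e1 : `|ev i0 : 'rV[R]_n| <= 1.
    apply: norm_le_coord => // j; rewrite !mxE; case: (_ && _); by rewrite ?normr1 ?normr0.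
  have h := rad_gt0 k; rewrite ger0_norm ?mulr_ge0 ?(ltW h)//.
  have := rad_le1 k; have := normr_ge0 (ev i0 : 'rV[R]_n); nra.
have := ler_normD (x - ctr k) (ctr k); rewrite subrK; lra.
Qed.

Lemma spikes_support x : `|p| + 4 < `|x| -> spikes x = 0.
Proof.
move=> px; rewrite /spikes; have [k [-> _]] := dsum_spec (@spike_disj) x.
by have [j /spike_support[]] := ctr_far k px.
Qed.

Lemma spike_continuous k : continuous (spike k).
Proof.
move=> x; apply: (@continuousM _ _ (cst b) (bump (ctr k) (rad k))).
  exact: cst_continuous.
exact: bump_continuous.
Qed.

Lemma dspike_continuous i k : continuous (dspike i k).
Proof.
move=> x; apply: (@continuousM _ _ (cst b) (dbump (ctr k) (rad k) i)).
  exact: cst_continuous.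
exact: dbump_continuous.
Qed.

Lemma is_derive_spike i k x : is_derive x (ev i) (spike k) (dspike i k x).
Proof.
have h := is_derive_bump (ctr k) (rad_gt0 k) i x.
exact: (is_deriveZ b).
Qed.

Lemma psum_continuous (a : nat -> 'rV[R]_n -> R) K : (forall k, continuous (a k)) ->
  continuous (fun x => \sum_(k < K) a k x).
Proof.
by move=> ca; apply: continuous_big => [|k _]; [exact: add_continuous|exact: ca].
Qed.

Lemma measurable_dsum (a : nat -> 'rV[R]_n -> R) : (forall k, continuous (a k)) ->
  (forall x j k, a j x != 0 -> a k x != 0 -> j = k) ->
  measurable_fun setT (dsum a \o tup2rv).
Proof.
move=> ca da; apply: (@measurable_fun_cvg _ _ _ _ (fun K => (fun x => \sum_(k < K) a k x) \o tup2rv)).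
  by move=> K; apply: continuous_measurable_tup2rv; exact: psum_continuous.
by move=> t _; exact: dsum_cvg.
Qed.

Lemma spikes_L2 : mu.-integrable setT (fun t => (spikes (tup2rv t) ^+ 2)%:E).
Proof.
apply: (@bounded_support_integrable _ _ _ hmu (fun t => spikes (tup2rv t) ^+ 2) (`|p| + 4) (b ^+ 2)).
- apply: measurable_funX; apply: measurable_dsum; [exact: spike_continuous|exact: spike_disj].
- move=> t; rewrite normrX -[leRHS]real_normK ?num_real// ler_sqr ?nnegrE//.
  exact: spikes_le.
- by move=> t /spikes_support ->; rewrite expr0n.
Qed.

Lemma dspike_le i k x : `|dspike i k x| <= 16 * `|b| / rad k.
Proof.
rewrite /dspike normrM [16 * _]mulrC -mulrA ler_wpM2l//.
by apply: dbump_le; exact: rad_gt0.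
Qed.

(** The derivative is at most [16 |b| / rad k] and lives on a cube of side [2 * rad k], so the
    energy is at most a constant times [rad k ^+ (n - 2)]. Since [n > 2] and [rad k <= 1], this
    power is at most [rad k], which is summable. *)
Lemma integral_dspike_sqr i k :
  (\int[mu]_t (dspike i k (tup2rv t) ^+ 2)%:E <= ((256 * b ^+ 2 * 2 ^+ n) * rad k)%:E)%E.
Proof.
have r0 := rad_gt0 k; have r1 := rad_le1 k.
pose A := @tbox R n [tuple ctr k 0 j - rad k | j < n] [tuple ctr k 0 j + rad k | j < n].
have mA : measurable A by exact: measurable_tbox.
have muA : (mu A = ((2 * rad k) ^+ n)%:E)%E.
  rewrite hmu => [|j]; last by rewrite !tnth_mktuple; lra.
  congr (_%:E); rewrite -[n in RHS]card_ord -prodr_const; apply: eq_bigr => j _.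
  by rewrite !tnth_mktuple; ring.
have mF : measurable_fun setT (fun t => dspike i k (tup2rv t) ^+ 2).
  by apply: measurable_funX; apply: continuous_measurable_tup2rv; exact: dspike_continuous.
have -> : (\int[mu]_t (dspike i k (tup2rv t) ^+ 2)%:E =
           \int[mu]_(t in A) (dspike i k (tup2rv t) ^+ 2)%:E)%E.
  rewrite [RHS]integral_mkcond; apply: eq_integral => t _.
  rewrite /patch; case: ifPn => // tA.
  have /existsNP[j /negP hj] : ~ forall j,
      tnth [tuple ctr k 0 j - rad k | j < n] j <= tnth t j <=
      tnth [tuple ctr k 0 j + rad k | j < n] j.
    by move: tA => /negP tA h; apply: tA; apply/mem_set.
  suff [_ ->] : spike k (tup2rv t) = 0 /\ forall i, dspike i k (tup2rv t) = 0.
    by rewrite expr0n.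
  apply: (@spike_support _ _ j); rewrite [tup2rv t 0 j]mxE leNgt; apply: contra hj.
  by rewrite !tnth_mktuple ltr_norml => /andP[? ?]; apply/andP; split; lra.
apply: (@le_trans _ _ (\int[mu]_(t in A) (cst ((16 * `|b| / rad k) ^+ 2)%:E t))%E).
  apply: ge0_le_integral => //.
  - by move=> t _; rewrite lee_fin sqr_ge0.
  - by apply/measurable_EFinP; exact: measurable_funTS.
  - move=> t _; rewrite lee_fin -[leLHS]real_normK ?num_real// ler_sqr ?nnegrE//.
      exact: dspike_le.
    by rewrite divr_ge0 ?mulr_ge0// ltW.
rewrite integral_cst// muA -EFinM lee_fin.
have -> : (16 * `|b| / rad k) ^+ 2 * (2 * rad k) ^+ n = 256 * b ^+ 2 * 2 ^+ n * (rad k ^+ (n - 2)).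
  rewrite -[b ^+ 2]real_normK ?num_real// [(2 * rad k) ^+ n]exprMn -[in rad k ^+ n](subnK (ltnW n2)) exprD.
  by field; rewrite gt_eqF.
have K0 : 0 <= 256 * b ^+ 2 * 2 ^+ n.
  by apply: mulr_ge0; [apply: mulr_ge0 => //; exact: sqr_ge0|exact: exprn_ge0].
apply: ler_wpM2l => //.
have : (0 < n - 2)%N by rewrite subn_gt0.
case: (n - 2)%N => // m _.
by rewrite exprS ler_piMr ?(ltW r0)// exprn_ile1// ltW.
Qed.

(** The bounds on the single derivatives grow with [k], so integrability comes from exchanging
    series and integral for nonnegative terms and comparing the energies with a geometric series. *)
Lemma dspikes_L2 i : mu.-integrable setT (fun t => (dspikes i (tup2rv t) ^+ 2)%:E).
Proof.
have mF k : measurable_fun setT (fun t => (dspike i k (tup2rv t) ^+ 2)%:E).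
  apply/measurable_EFinP; apply: measurable_funX.
  by apply: continuous_measurable_tup2rv; exact: dspike_continuous.
have mg : measurable_fun setT (fun t => (dspikes i (tup2rv t) ^+ 2)%:E).
  apply/measurable_EFinP; apply: measurable_funX; apply: measurable_dsum.
    exact: dspike_continuous.
  exact: dspike_disj.
apply/integrableP; split => //.
set K := 256 * b ^+ 2 * 2 ^+ n.
have F0 k (t : n.-tuple R) : setT t -> (0 <= (dspike i k (tup2rv t) ^+ 2)%:E)%E.
  by move=> _; rewrite lee_fin sqr_ge0.
apply: (@le_lt_trans _ _ (\int[mu]_t (\sum_(k <oo) (dspike i k (tup2rv t) ^+ 2)%:E))%E).
  apply: ge0_le_integral => //.
  - exact: measurableT_comp.
  - by apply: ge0_emeasurable_sum => // k t _ _; exact: F0.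
  (* By disjointness the square of the sum is one of the squares in the series. *)
  - move=> t _; rewrite gee0_abs ?lee_fin ?sqr_ge0//.
    rewrite /dspikes; have [k [-> _]] := dsum_spec (@dspike_disj i) (tup2rv t).
    apply: le_trans (nneseries_lim_ge k.+1 _); last by move=> *; exact: F0.
    rewrite big_nat_recr//= leeDr// sume_ge0// => j _; exact: F0.
rewrite integral_nneseries//.
apply: (@le_lt_trans _ _ (\sum_(k <oo) (K * rad k)%:E)%E).
  apply: lee_nneseries => k _; first by move=> _; apply: integral_ge0 => t; exact: F0.
  exact: integral_dspike_sqr.
(* Rewriting [K * 2^-k] as [2K / 2^(k+1)] matches the indexing of the geometric series. *)
have -> : (fun N => \sum_(0 <= k < N) (K * rad k)%:E)%E =
   eseries (fun k => ((2 * K) / (2 ^ (k + 1))%:R)%:E).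
  apply/funext => N; rewrite /eseries /=; apply: eq_bigr => k _; congr EFin.
  rewrite addn1 expnS natrM natrX /rad exprVn; field.
  by rewrite expf_neq0.
by rewrite (cvg_lim _ (@cvg_geometric_eseries_half R (2 * K) 0))// ltry.
Qed.

End Spikes.

(** * Elementary properties of test functions *)

Section TestFunctions.
Context {R : realType} {n : nat}.
Variables (Om : set 'rV[R]_n) (phi : 'rV[R]_n -> R).
Hypothesis tphi : test_fun Om phi.

Lemma test_fun_continuous : continuous phi.
Proof. by have [/(_ [::])[]] := tphi. Qed.

Lemma test_fun_derivable x v : derivable phi x v.
Proof. by have [/(_ [::])[_]] := tphi; exact. Qed.

Lemma test_fun_derive_continuous v : continuous ('D_v phi).
Proof. by have [/(_ [:: v])[]] := tphi. Qed.

Lemma test_fun_eq0 x : ~ Om x -> phi x = 0.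
Proof.
move=> Ox; apply/eqP/negP => /negP p0; apply: Ox.
by have [_ [_]] := tphi; apply; exact: subset_closure.
Qed.

(** The complement of the support is open, so [phi] vanishes on a whole neighbourhood of [x]. *)
Lemma test_fun_derive_eq0 x v : ~ Om x -> 'D_v phi x = 0.
Proof.
move=> Ox; rewrite -[RHS](derive_cst (0 : R) x v); apply: near_eq_derive.
have [_ [_ sub]] := tphi.
have : nbhs x (~` fsupport phi).
  apply: open_nbhs_nbhs; split; last by move/sub.
  exact/closed_openC/closed_closure.
apply: filterS => y ny; apply/eqP/negP => /negP p0; apply: ny.
exact: subset_closure.
Qed.

Lemma test_fun_support : exists r, forall x, r < `|x| -> phi x = 0.
Proof.
have [_ [/compact_bounded[M [_ hM]] _]] := tphi.
exists (`|M| + 1) => x Mx; apply/eqP/negP => /negP p0.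
have : `|x| <= `|M| + 1.
  by apply: hM; [rewrite ltr_pwDr// ler_norm|exact: subset_closure].
by rewrite leNgt Mx.
Qed.

End TestFunctions.

(** * Weak derivatives of the spikes and membership in [H1] *)

Section SpikesH1.
Context {R : realType} {n : nat}.
Variables (mu : {measure set (n.-tuple R) -> \bar R}) (hmu : is_lebesgue_Rn mu).
Variables (p : 'rV[R]_n) (b : R) (i0 : 'I_n).
Hypothesis n2 : (2 < n)%N.
Implicit Types x : 'rV[R]_n.
Local Notation u := (spikes p b i0).
Local Notation g := (dspikes p b i0).

(** Finite sums of spikes satisfy classical integration by parts, and both sides pass to the limit
    by dominated convergence. *)
Lemma spikes_weak_partial (Om : set 'rV[R]_n) i : weak_partial mu Om i u (g i).
Proof.
move=> phi tphi.
have cphi := test_fun_continuous tphi.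
have dphi x : derivable phi x (ev i) by apply: (@test_fun_derivable _ _ _ _ tphi).
have cdphi : continuous ('D_(ev i) phi) by apply: (@test_fun_derive_continuous _ _ _ _ tphi).
have [r phi0] := test_fun_support tphi.
have dphi0 := derive_support (ev i) phi0.
have [M M0 hM] := continuous_bounded_support cdphi dphi0.
(* Both integrands vanish outside [Om], so the integrals may be taken over the whole space, where
   translation invariance was used. *)
have restrict (h : 'rV[R]_n -> R) : (forall x, ~ Om x -> h x = 0) ->
    (\int[mu]_(t in tdom Om) (h (tup2rv t))%:E = \int[mu]_t (h (tup2rv t))%:E)%E.
  move=> h0; rewrite integral_mkcond; apply: eq_integral => t _.
  rewrite /patch; case: ifPn => // /negP tO; rewrite h0// => Ot.
  by apply: tO; apply/mem_set.
rewrite (restrict (fun x => u x * 'D_(ev i) phi x)); last first.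
  by move=> x /(test_fun_derive_eq0 tphi) ->; rewrite mulr0.
rewrite (restrict (fun x => g i x * phi x)); last first.
  by move=> x /(test_fun_eq0 tphi) ->; rewrite mulr0.
pose uK K : 'rV[R]_n -> R := fun x => \sum_(k < K) spike p b i0 k x.
pose gK K : 'rV[R]_n -> R := fun x => \sum_(k < K) dspike p b i0 i k x.
have cu K : continuous (uK K) by apply: psum_continuous => k; exact: spike_continuous.
have cg K : continuous (gK K) by apply: psum_continuous => k; exact: dspike_continuous.
have du K x : is_derive x (ev i) (uK K) (gK K x).
  have := is_derive_sum (fun k : 'I_K => is_derive_spike p b i0 i k x).
  by rewrite (_ : \sum_(k < K) spike p b i0 k = uK K)//; apply/funext => y; rewrite fct_sumE.
have DE K : 'D_(ev i) (uK K) = gK K by apply/funext => x; have [] := du K x.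
have IBP K : (\int[mu]_t (uK K (tup2rv t) * 'D_(ev i) phi (tup2rv t))%:E =
    - \int[mu]_t (gK K (tup2rv t) * phi (tup2rv t))%:E)%E.
  rewrite -DE; apply: (@integration_by_parts _ _ _ hmu _ _ _ r) => //.
  by rewrite DE; exact: cg.
have L : (\int[mu]_t (uK K (tup2rv t) * 'D_(ev i) phi (tup2rv t))%:E @[K --> \oo] -->
    \int[mu]_t (u (tup2rv t) * 'D_(ev i) phi (tup2rv t))%:E)%E.
  apply: (@bounded_support_cvg _ _ _ hmu (fun K x => uK K x * 'D_(ev i) phi x)
      (fun x => u x * 'D_(ev i) phi x) r (`|b| * M)).
  - move=> K; apply: continuous_measurable_tup2rv => x.
    by apply: (@continuousM _ _ (uK K) ('D_(ev i) phi)); [exact: cu|exact: cdphi].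
  - move=> K x; rewrite normrM ler_pM//.
    apply: le_trans (spikes_le p b i0 x).
    exact: (psum_le_dsum (@spike_disj _ _ p b i0)).
  - by move=> K x rx; rewrite dphi0// mulr0.
  - move=> x; apply: cvgMl; exact: (dsum_cvg (@spike_disj _ _ p b i0)).
(* The partial sums of derivatives are dominated through [|g phi| <= g^2 + phi^2], whose right side
   is integrable by the energy estimate. *)
have igp : mu.-integrable setT (fun t => (g i (tup2rv t) ^+ 2)%:E + (phi (tup2rv t) ^+ 2)%:E)%E.
  apply: integrableD => //; first exact: dspikes_L2.
  apply: (@continuous_support_integrable _ _ _ hmu (fun x => phi x ^+ 2) r).
    by move=> x; apply: (@continuousM _ _ phi phi); exact: cphi.
  by move=> x rx; rewrite phi0// expr0n.
have Rt : (\int[mu]_t (gK K (tup2rv t) * phi (tup2rv t))%:E @[K --> \oo] -->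
    \int[mu]_t (g i (tup2rv t) * phi (tup2rv t))%:E)%E.
  apply: (@dominated_cvg _ _ _ mu setT measurableT
    (fun K t => (gK K (tup2rv t) * phi (tup2rv t))%:E) _
    (fun t => (g i (tup2rv t) ^+ 2)%:E + (phi (tup2rv t) ^+ 2)%:E)%E) => //.
  - move=> K; apply/measurable_EFinP.
    apply: (@continuous_measurable_tup2rv _ _ (fun x => gK K x * phi x)) => x.
    by apply: (@continuousM _ _ (gK K) phi); [exact: cg|exact: cphi].
  - move=> t _; apply/cvg_EFin; first exact: nearW.
    apply: cvgMl; exact: (dsum_cvg (@dspike_disj _ _ p b i0 i)).
  - move=> K t _; rewrite -EFinD lee_fin normrM.
    have := psum_le_dsum (@dspike_disj _ _ p b i0 i) K (tup2rv t).
    rewrite -/(g i _) -/(gK K _).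
    rewrite -[g i _ ^+ 2]real_normK ?num_real// -[phi _ ^+ 2]real_normK ?num_real//.
    set c := `|gK _ _|; set d := `|g i _|; set e := `|phi _| => cd.
    have e0 : 0 <= e by exact: normr_ge0.
    have : c * e <= d * e by exact: ler_wpM2r.
    by have := sqr_ge0 (d - e); have := sqr_ge0 (d + e); nra.
have := cvgeN Rt.
under eq_fun do rewrite -IBP.
by move=> N; move/cvg_unique : L => /(_ _ _ (N _)); apply.
Qed.

Lemma spikes_H1 (Om : set 'rV[R]_n) : open Om -> H1 mu Om u.
Proof.
move=> oOm; have mOm : measurable (tdom Om) by exact: measurable_tup2rv_open.
have L2P (h : 'rV[R]_n -> R) : measurable_fun setT (h \o tup2rv) ->
    mu.-integrable setT (fun t => (h (tup2rv t) ^+ 2)%:E) -> L2 mu Om h.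
  move=> mh ih; split; first exact: measurable_funTS.
  have /integrableP[_] := integrableS measurableT mOm (@subsetT _ _) ih.
  apply: le_lt_trans; rewrite le_eqVlt; apply/orP; left; apply/eqP.
  by apply: eq_integral => t _; rewrite real_normK ?num_real// gee0_abs// lee_fin sqr_ge0.
split.
  apply: L2P; last exact: spikes_L2.
  by apply: measurable_dsum; [exact: spike_continuous|exact: spike_disj].
move=> i; exists (g i); split; last exact: spikes_weak_partial.
apply: L2P; last exact: dspikes_L2.
by apply: measurable_dsum; [exact: dspike_continuous|exact: dspike_disj].
Qed.

End SpikesH1.

(** * Values of continuous representatives *)

Section SpikeValues.
Context {R : realType} {n : nat}.
Variables (p : 'rV[R]_n) (b : R) (i0 : 'I_n).
Implicit Types x : 'rV[R]_n.

Lemma spikes_eq k x : b != 0 ->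
  (forall j, `|x 0 j - ctr p i0 k 0 j| <= rad k / (2 * n%:R)) -> spikes p b i0 x = b.
Proof.
move=> b0 xk; have sk : spike p b i0 k x = b.
  by rewrite /spike bump_eq1 ?rad_gt0// mulr1.
rewrite -[RHS]sk /spikes; have [j [-> sj]] := dsum_spec (@spike_disj _ _ p b i0) x.
(* Comparing the partial sums of lengths [k] and [k + 1] shows [j = k]; any other index would force
   [b = 0]. *)
have := sj k.+1; rewrite big_ord_recr /= sj sk ltnS.
case: ltngtP => [_|_|-> //]; last by rewrite add0r => e; rewrite e eqxx in b0.
by move/eqP; rewrite -subr_eq0 addrAC subrr add0r (negbTE b0).
Qed.

Lemma spikes_eq0 x : x 0 i0 <= p 0 i0 -> spikes p b i0 x = 0.
Proof.
move=> xp; rewrite /spikes; have [k [-> _]] := dsum_spec (@spike_disj _ _ p b i0) x.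
have r0 := rad_gt0 (R := R) k.
apply: (proj1 (@spike_support _ _ p b i0 k x i0 _)); rewrite leNgt; apply/negP => /ctr_slab.
by move=> /andP[]; lra.
Qed.

End SpikeValues.

Section EssentialValue.
Context {R : realType} {n : nat}.
Variables (mu : {measure set (n.-tuple R) -> \bar R}) (hmu : is_lebesgue_Rn mu).
Implicit Types x y p : 'rV[R]_n.

(** If [f c] differed from [G p], then [G] would avoid the value [f c] near [p]. A box near [p] on
    which [u = c] would then lie in the exceptional null set, although its volume is positive. *)
Lemma value_of_continuous_representative (Om : set 'rV[R]_n) (f : R -> R)
    (u G : 'rV[R]_n -> R) p (c : R) : open Om -> Om p ->
  {within closure Om, continuous G} ->
  {ae mu, forall t, tdom Om t -> (f \o u) (tup2rv t) = G (tup2rv t)} ->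
  (forall e, 0 < e -> exists y s, 0 < s /\
    forall x, (forall j, `|x 0 j - y 0 j| <= s) -> u x = c /\ `|x - p| < e) ->
  f c = G p.
Proof.
move=> oOm Omp cG aeG H; apply: contrapT => /eqP fG.
(* Continuity relative to the closure becomes ordinary continuity at [p] because [Om] is an open set
   containing [p]. *)
have cGp : {for p, continuous G}.
  have := continuous_subspaceW (@subset_closure _ Om) cG.
  by rewrite continuous_open_subspace// => /(_ p); apply; exact/mem_set.
have e0 : 0 < `|f c - G p| by rewrite normr_gt0 subr_eq0.
have /cvgrPdist_lt /(_ _ e0) /nbhs_ballP[e1 /= e10 Ge1] := cGp.
have /nbhs_ballP[e2 /= e20 Oe2] : nbhs p Om by exact: open_nbhs_nbhs.
have [|y [s [s0 Hx]]] := H (Num.min e1 e2); first by rewrite lt_min e10.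
pose A := @tbox R n [tuple y 0 j - s | j < n] [tuple y 0 j + s | j < n].
have mA : measurable A by exact: measurable_tbox.
have muA : (0 < mu A)%E.
  rewrite hmu => [|j]; last by rewrite !tnth_mktuple; lra.
  by rewrite lte_fin prodr_gt0// => j _; rewrite !tnth_mktuple; lra.
have [N [mN N0 subN]] := aeG.
have AN : A `<=` N.
  move=> t At; apply: subN => /= P.
  have [|uc] := Hx (tup2rv t).
    move=> j; have := At j; rewrite mxE !tnth_mktuple => /andP[? ?].
    by rewrite ler_norml; apply/andP; split; lra.
  rewrite lt_min => /andP[d1 d2].
  have Ot : Om (tup2rv t) by apply: Oe2; rewrite -ball_normE /= distrC.
  have Gt := Ge1 (tup2rv t); rewrite -ball_normE /= distrC in Gt.
  have := Gt d1; rewrite -(P Ot) /= uc distrC ltxx.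
  by [].
by move: muA; rewrite (subset_measure0 mA mN AN N0) ltxx.
Qed.

End EssentialValue.

Unset Implicit Arguments.
Set Strict Implicit.

Theorem theorem2p1 (R : realType) (n : nat)
    (mu : {measure set (n.-tuple R) -> \bar R})
    (hmu : is_lebesgue_Rn mu)
    (Om : set 'rV[R]_n) (f : R -> R) :
  (2 < n)%N -> domain Om ->
  (forall u : 'rV[R]_n -> R, H1 mu Om u -> C0_closure mu Om (f \o u)) ->
  exists c : R, forall x, f x = c.
Proof.
move=> n2 [oOm [_ [p Omp]]] Hf; exists (f 0) => b.
have [->//|b0] := eqVneq b 0.
have n0 : (0 < n)%N by exact: leq_trans n2.
pose i0 := Ordinal n0.
have nR : 1 <= n%:R :> R by rewrite ler1n.
have [G [cG aeG]] := Hf _ (spikes_H1 hmu p b i0 n2 oOm).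
have small e : 0 < e -> exists k, 4 * rad k < e :> R.
  move=> e0; have h : (2^-1 : R) ^+ k @[k --> \oo] --> (0 : R).
    by apply: cvg_expr; rewrite ger0_norm// invf_lt1// ltr1n.
  have e4 : 0 < e / 4 by rewrite divr_gt0.
  have /cvgrPdist_lt /(_ _ e4)[k _ /(_ k (leqnn k))] := h.
  rewrite /= sub0r normrN ger0_norm ?exprn_ge0 ?invr_ge0// -/(rad k) => ke.
  by exists k; lra.
(* Boxes centred within [3 * rad k] of [p] with half-side at most [rad k] stay within [4 * rad k] of
   [p], hence shrink to [p]. *)
have near k (s : R) (x y : 'rV[R]_n) : 0 <= s -> s <= rad k -> `|y - p| <= 3 * rad k ->
    (forall j, `|x 0 j - y 0 j| <= s) -> `|x - p| <= 4 * rad k.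
  move=> s0 sk yp xy; have : `|x - y| <= s by apply: norm_le_coord => // j; rewrite !mxE.
  have := ler_normD (x - y) (y - p); rewrite addrA subrK; lra.
have e1 : `|ev i0 : 'rV[R]_n| <= 1.
  by apply: norm_le_coord => // j; rewrite !mxE; case: (_ && _); rewrite ?normr1 ?normr0.
have val := value_of_continuous_representative hmu oOm Omp cG aeG.
transitivity (G p); [|apply/esym].
(* Value [b]: the plateaus of the spikes. *)
- apply: val => e /small[k ke]; have r0 := @rad_gt0 R k.
  exists (ctr p i0 k), (rad k / (2 * n%:R)).
  have s0 : 0 < rad k / (2 * n%:R :> R) by apply: divr_gt0 => //; lra.
  split => // x xk; split; first exact: spikes_eq xk.
  apply: le_lt_trans ke; apply: near xk; first exact: ltW.
    by rewrite ler_pdivrMr ?ler_peMr ?(ltW r0)//; [|apply: mulr_gt0]; lra.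
  rewrite /ctr addrC addKr normrZ ger0_norm; last by rewrite mulr_ge0// ltW.
  by rewrite ler_piMr// mulr_ge0// ltW.
(* Value [0]: boxes mirrored to the other side of [p], where no spike reaches. *)
- apply: val => e /small[k ke]; have r0 := @rad_gt0 R k.
  exists (p - (3 * rad k) *: ev i0), (rad k); split => // x xk; split.
    apply: spikes_eq0; have := xk i0; rewrite !mxE !eqxx mulr1 ler_norml.
    by move=> /andP[]; lra.
  apply: le_lt_trans ke; apply: near xk => //; first exact: ltW.
  rewrite addrC addKr normrN normrZ ger0_norm; last by rewrite mulr_ge0// ltW.
  by rewrite ler_piMr// mulr_ge0// ltW.
Qed.
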